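(* Let $G_1$, $G_2$ be generators over event sets $\Sigma_1$, $\Sigma_2$, and let $G_k$ be a generator (coordinator) over $\Sigma_k$ with $\Sigma_1\cap\Sigma_2\subseteq\Sigma_k\subseteq\Sigma_1\cup\Sigma_2$. Let $K\subseteq L_m(G_1\parallel G_2\parallel G_k)$ be a language such that $K$ and $\overline K$ are conditionally decomposable with respect to $\Sigma_1,\Sigma_2,\Sigma_k$. Define $$\sup\mathrm{CRO}_k=\sup\mathrm{CRO}(P_k(K),L(G_k)),$$ $$\sup\mathrm{CRO}_{i+k}=\sup\mathrm{CRO}\big(P_{i+k}(K),\,L(G_i)\parallel\overline{\sup\mathrm{CRO}_k}\big),\quad i=1,2.$$ Assume that $\sup\mathrm{CRO}_{1+k}$ and $\sup\mathrm{CRO}_{2+k}$ are nonconflicting, and let $M=\sup\mathrm{CRO}_{1+k}\parallel\sup\mathrm{CRO}_{2+k}$ and $L=L(G_1\parallel G_2\parallel G_k)$. If $P_k(M)$ is controllable with respect to $L(G_k)$ and $\Sigma_{k,u}$, and $P_k(C)$-observable with respect to $L(G_k)$ and $Q_k$ for some language $C$ with $M\subseteq C\subseteq L$, then $M$ is conditionally controllable with respect to $G_1,G_2,G_k$ and $\Sigma_{1,u},\Sigma_{2,u},\Sigma_{k,u}$, and conditionally observable with respect to $G_1,G_2,G_k$ and $Q_{1+k},Q_{2+k},Q_k$. Moreover, $M$ contains the language $\sup\mathrm{cCSRO}$, the supremal conditionally controllable and conditionally strong $K$-observable sublanguage of $K$.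
   Context: Languages are sets of finite words. A generator $G=(Q,\Sigma,f,q_0,Q_m)$ is a finite deterministic automaton with partial transition function $f$; $L(G)=\{s\in\Sigma^*\mid f(q_0,s)\text{ is defined}\}$ is its (prefix-closed) generated language and $L_m(G)=\{s\in\Sigma^*\mid f(q_0,s)\in Q_m\}\subseteq L(G)$ its marked language. $\overline{L}$ denotes the prefix closure of $L$. For $\Sigma'\subseteq\Sigma$ the projection $\Sigma^*\to\Sigma'^*$ is the homomorphism erasing events outside $\Sigma'$ and fixing events of $\Sigma'$. For $L_1\subseteq\Sigma_1^*$, $L_2\subseteq\Sigma_2^*$, the synchronous product is $L_1\parallel L_2=P_1^{-1}(L_1)\cap P_2^{-1}(L_2)\subseteq(\Sigma_1\cup\Sigma_2)^*$, where $P_i:(\Sigma_1\cup\Sigma_2)^*\to\Sigma_i^*$ are projections; the synchronous product of generators satisfies $L(G_1\parallel G_2)=L(G_1)\parallel L(G_2)$ and $L_m(G_1\parallel G_2)=L_m(G_1)\parallel L_m(G_2)$. Languages $L_1,L_2$ are nonconflicting if $\overline{L_1\parallel L_2}=\overline{L_1}\parallel\overline{L_2}$. Let $\Sigma=\Sigma_1\cup\Sigma_2$, partitioned into controllable events $\Sigma_c$ and uncontrollable events $\Sigma_u=\Sigma\setminus\Sigma_c$, and let $\Sigma_o\subseteq\Sigma$ be the observable events. Write $\Sigma_{i+k}=\Sigma_i\cup\Sigma_k$, $\Sigma_{j,u}=\Sigma_j\cap\Sigma_u$, $\Sigma_{j,o}=\Sigma_j\cap\Sigma_o$. $P_k:\Sigma^*\to\Sigma_k^*$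 and $P_{i+k}:\Sigma^*\to\Sigma_{i+k}^*$ ($i=1,2$) are projections, and $Q_j:\Sigma_j^*\to\Sigma_{j,o}^*$, for $j=1+k,2+k,k$, are the observation projections. A language $K\subseteq\Sigma^*$ is conditionally decomposable with respect to $\Sigma_1,\Sigma_2,\Sigma_k$ if $K=P_{1+k}(K)\parallel P_{2+k}(K)$. Basic notions, for languages over an event set $\Delta$, a prefix-closed $L\subseteq\Delta^*$, $\Delta_u\subseteq\Delta$, and a projection $Q:\Delta^*\to\Delta_o^*$: - $K\subseteq L$ is controllable with respect to $L$ and $\Delta_u$ if $\overline K\Delta_u\cap L\subseteq\overline K$. - For $K\subseteq C$, $K$ is $C$-observable with respect to $L$ and $Q$ if for all $s,s'\in\Delta^*$ with $Q(s)=Q(s')$ and all $\sigma\in\Delta$: $s\sigma\in\overline K$, $s'\in\overline C$ and $s'\sigma\in L$ imply $s'\sigma\in\overline K$. - $K$ is observable with respect to $L$ and $Q$ if it is $K$-observable with respect to $L$ and $Q$. - For $K$ and prefix-closed $L$ over $\Sigma_j$ ($j\in\{k,1+k,2+k\}$), $\sup\mathrm{CRO}(K,L)$ is the supremal sublanguage of $K$ that is controllable with respect to $L$ and $\Sigma_{j,u}$ and $(K\cap L)$-observable with respect to $L$ and $Q_j$, i.e. the union of all $K'\subseteq K\cap L$ having these two properties (this union has them too). Conditional notions, for $K\subseteq L_m(G_1\parallel G_2\parallel G_k)$: - $K$ is conditionally controllable with respect to $G_1,G_2,G_k$ and $\Sigma_{1,u},\Sigma_{2,u},\Sigma_{k,u}$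 if $P_k(K)$ is controllable with respect to $L(G_k)$ and $\Sigma_{k,u}$, and, for $i=1,2$, $P_{i+k}(K)$ is controllable with respect to $L(G_i)\parallel\overline{P_k(K)}$ and $\Sigma_{i+k,u}$. - $K$ is conditionally observable with respect to $G_1,G_2,G_k$ and $Q_{1+k},Q_{2+k},Q_k$ if $P_k(K)$ is observable with respect to $L(G_k)$ and $Q_k$, and, for $i=1,2$, $P_{i+k}(K)$ is observable with respect to $L(G_i)\parallel\overline{P_k(K)}$ and $Q_{i+k}$. - For $K\subseteq C\subseteq L_m(G_1\parallel G_2\parallel G_k)$, $K$ is conditionally strong $C$-observable with respect to $G_1,G_2,G_k$ and $Q_{1+k},Q_{2+k},Q_k$ if $P_k(K)$ is $P_k(C)$-observable with respect to $L(G_k)$ and $Q_k$, and, for $i=1,2$, $P_{i+k}(K)$ is $P_{i+k}(C)$-observable with respect to $L(G_i)\parallel L(G_k)$ and $Q_{i+k}$. - $\sup\mathrm{cCSRO}$ is the union of all sublanguages of $K$ that are both conditionally controllable with respect to $G_1,G_2,G_k$ and $\Sigma_{1,u},\Sigma_{2,u},\Sigma_{k,u}$ and conditionally strong $K$-observable with respect to $G_1,G_2,G_k$ and $Q_{1+k},Q_{2+k},Q_k$ (this union has both properties). *)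

(* Defs.v *)
(* The events form a finite type [E]; the event sets Sigma_1, Sigma_2, ... are
   subsets of [E], and a language over Sigma' is a set of words of [seq E] all
   of whose letters lie in Sigma'. *)
From HB Require Import structures.
From mathcomp Require Import all_boot.
From mathcomp Require Import boolp classical_sets.

Set Implicit Arguments.
Unset Strict Implicit.
Unset Printing Implicit Defensive.

Local Open Scope classical_set_scope.

Definition language (E : finType) := set (seq E).

Definition words (E : finType) (S : {set E}) : language E :=
  [set w | all (fun a => a \in S) w].

Definition pclosure (E : finType) (L : language E) : language E :=
  [set s | exists2 w, L w & prefix s w].

Definition proj (E : finType) (S : {set E}) (w : seq E) : seq E :=
  [seq a <- w | a \in S].

(* The event sets are explicit: L1 || L2 depends on them. *)
Definition sync (E : finType) (S1 S2 : {set E}) (L1 L2 : language E) :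
    language E :=
  words (S1 :|: S2) `&` (proj S1 @^-1` L1) `&` (proj S2 @^-1` L2).

Definition nonconflicting (E : finType) (S1 S2 : {set E})
    (L1 L2 : language E) : Prop :=
  pclosure (sync S1 S2 L1 L2) = sync S1 S2 (pclosure L1) (pclosure L2).

(* The partial map f : Q * S -> Q is extended by "undefined" to events
   outside S. *)
Record generator (E : finType) (S : {set E}) := Generator {
  gstate : finType;
  gtrans : gstate -> E -> option gstate;
  ginit : gstate;
  gmarked : {set gstate};
  gtrans_over : forall q a, a \notin S -> gtrans q a = None }.

Fixpoint grun (E : finType) (S : {set E}) (G : generator S) (q : gstate G)
    (w : seq E) : option (gstate G) :=
  if w is a :: w' then obind (fun q' => grun q' w') (gtrans q a) else Some q.

Definition gen_lang (E : finType) (S : {set E}) (G : generator S) :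
    language E :=
  [set w | isSome (grun (ginit G) w)].

Definition marked_lang (E : finType) (S : {set E}) (G : generator S) :
    language E :=
  [set w | exists2 q, grun (ginit G) w = Some q & q \in gmarked G].

(* In a synchronous product, a component stays put on events that it does not
   have. *)
Definition gstep (E : finType) (S : {set E}) (G : generator S) (q : gstate G)
    (a : E) : option (gstate G) :=
  if a \in S then gtrans q a else Some q.

Definition sync_trans (E : finType) (S1 S2 : {set E}) (G1 : generator S1)
    (G2 : generator S2) (q : gstate G1 * gstate G2) (a : E) :
    option (gstate G1 * gstate G2) :=
  if a \in S1 :|: S2 then
    if (gstep q.1 a, gstep q.2 a) is (Some q1, Some q2) then Some (q1, q2)
    else None
  else None.

Lemma sync_trans_over (E : finType) (S1 S2 : {set E}) (G1 : generator S1)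
    (G2 : generator S2) (q : gstate G1 * gstate G2) (a : E) :
  a \notin S1 :|: S2 -> sync_trans q a = None.
Proof. by rewrite /sync_trans => /negbTE ->. Qed.

Definition sync_gen (E : finType) (S1 S2 : {set E}) (G1 : generator S1)
    (G2 : generator S2) : generator (S1 :|: S2) :=
  {| gstate := (gstate G1 * gstate G2)%type;
     gtrans := @sync_trans E S1 S2 G1 G2;
     ginit := (ginit G1, ginit G2);
     gmarked := finset.setX (gmarked G1) (gmarked G2);
     gtrans_over := @sync_trans_over E S1 S2 G1 G2 |}.

Lemma grun_sync (E : finType) (S1 S2 : {set E}) (G1 : generator S1)
    (G2 : generator S2) (w : seq E) (q : gstate G1 * gstate G2) :
  @grun E _ (sync_gen G1 G2) q w =
  if all (fun a => a \in S1 :|: S2) w then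
    if (grun q.1 (proj S1 w), grun q.2 (proj S2 w)) is (Some q1, Some q2)
    then Some (q1, q2) else None
  else None.
Proof.
elim: w q => [[q1 q2]//|a w IH] [q1 q2] /=.
rewrite /sync_trans /gstep /= finset.in_setU.
case: (a \in S1); case: (a \in S2) => //=;
  do 2?[case: (gtrans _ _) => [?|] //=]; rewrite ?IH //=;
  case: (all _ w) => //; by case: (grun _ _).
Qed.

Lemma gen_lang_sync (E : finType) (S1 S2 : {set E}) (G1 : generator S1)
    (G2 : generator S2) :
  gen_lang (sync_gen G1 G2) = sync S1 S2 (gen_lang G1) (gen_lang G2).
Proof.
apply/seteqP; rewrite /gen_lang /sync /words; split=> w /=; rewrite grun_sync /=.
  by case: (all _ w) => //; case: (grun _ _) => // ?; case: (grun _ _).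
by case=> -[-> ]; case: (grun _ _) => // ? _; case: (grun _ _).
Qed.

Lemma marked_lang_sync (E : finType) (S1 S2 : {set E}) (G1 : generator S1)
    (G2 : generator S2) :
  marked_lang (sync_gen G1 G2) = sync S1 S2 (marked_lang G1) (marked_lang G2).
Proof.
apply/seteqP; rewrite /marked_lang /sync /words; split=> w /=.
  case=> q; rewrite grun_sync /=; case: (all _ w) => //.
  case: (grun _ (proj S1 w)) => // q1; case: (grun _ (proj S2 w)) => // q2.
  case=> <-; rewrite finset.in_setX => /andP[h1 h2].
  by split; [split=> //; exists q1|exists q2].
case=> -[wS [q1 e1 h1]] [q2 e2 h2]; exists (q1, q2).
  by rewrite grun_sync /= wS e1 e2.
by rewrite finset.in_setX h1 h2.
Qed.

Definition cond_decomposable (E : finType) (S1 S2 Sk : {set E})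
    (K : language E) : Prop :=
  K = sync (S1 :|: Sk) (S2 :|: Sk) (proj (S1 :|: Sk) @` K)
        (proj (S2 :|: Sk) @` K).

Definition controllable (E : finType) (L : language E) (Du : {set E})
    (K : language E) : Prop :=
  K `<=` L /\
  forall (s : seq E) (a : E), pclosure K s -> a \in Du -> L (rcons s a) ->
    pclosure K (rcons s a).

(* K is C-observable with respect to L and Q, over the event set D. *)
Definition rel_observable (E : finType) (D : {set E}) (L : language E)
    (Q : seq E -> seq E) (C K : language E) : Prop :=
  K `<=` C /\
  forall (s s' : seq E) (a : E), words D s -> words D s' -> a \in D ->
    Q s = Q s' -> pclosure K (rcons s a) -> pclosure C s' ->
    L (rcons s' a) -> pclosure K (rcons s' a).

Definition observable (E : finType) (D : {set E}) (L : language E)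
    (Q : seq E -> seq E) (K : language E) : Prop :=
  rel_observable D L Q K K.

(* Over the event set D, with D_u = D :&: Su and Q : D^* -> (D :&: So)^*. *)
Definition supCRO (E : finType) (D Su So : {set E}) (K L : language E) :
    language E :=
  \bigcup_(K' in [set K' | [/\ K' `<=` K `&` L,
                               controllable L (D :&: Su) K' &
                               rel_observable D L (proj (D :&: So))
                                 (K `&` L) K']]) K'.

Definition cond_controllable (E : finType) (S1 S2 Sk : {set E})
    (G1 : generator S1) (G2 : generator S2) (Gk : generator Sk)
    (Su : {set E}) (K : language E) : Prop :=
  let Pk := proj Sk in
  let P1k := proj (S1 :|: Sk) in
  let P2k := proj (S2 :|: Sk) in
  [/\ K `<=` marked_lang (sync_gen (sync_gen G1 G2) Gk),
      controllable (gen_lang Gk) (Sk :&: Su) (Pk @` K),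
      controllable (sync S1 Sk (gen_lang G1) (pclosure (Pk @` K)))
        ((S1 :|: Sk) :&: Su) (P1k @` K) &
      controllable (sync S2 Sk (gen_lang G2) (pclosure (Pk @` K)))
        ((S2 :|: Sk) :&: Su) (P2k @` K)].

Definition cond_observable (E : finType) (S1 S2 Sk : {set E})
    (G1 : generator S1) (G2 : generator S2) (Gk : generator Sk)
    (So : {set E}) (K : language E) : Prop :=
  let Pk := proj Sk in
  let P1k := proj (S1 :|: Sk) in
  let P2k := proj (S2 :|: Sk) in
  [/\ K `<=` marked_lang (sync_gen (sync_gen G1 G2) Gk),
      observable Sk (gen_lang Gk) (proj (Sk :&: So)) (Pk @` K),
      observable (S1 :|: Sk) (sync S1 Sk (gen_lang G1) (pclosure (Pk @` K)))
        (proj ((S1 :|: Sk) :&: So)) (P1k @` K) &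
      observable (S2 :|: Sk) (sync S2 Sk (gen_lang G2) (pclosure (Pk @` K)))
        (proj ((S2 :|: Sk) :&: So)) (P2k @` K)].

Definition cond_strong_observable (E : finType) (S1 S2 Sk : {set E})
    (G1 : generator S1) (G2 : generator S2) (Gk : generator Sk)
    (So : {set E}) (C K : language E) : Prop :=
  let Pk := proj Sk in
  let P1k := proj (S1 :|: Sk) in
  let P2k := proj (S2 :|: Sk) in
  [/\ K `<=` C /\ C `<=` marked_lang (sync_gen (sync_gen G1 G2) Gk),
      rel_observable Sk (gen_lang Gk) (proj (Sk :&: So)) (Pk @` C) (Pk @` K),
      rel_observable (S1 :|: Sk) (sync S1 Sk (gen_lang G1) (gen_lang Gk))
        (proj ((S1 :|: Sk) :&: So)) (P1k @` C) (P1k @` K) &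
      rel_observable (S2 :|: Sk) (sync S2 Sk (gen_lang G2) (gen_lang Gk))
        (proj ((S2 :|: Sk) :&: So)) (P2k @` C) (P2k @` K)].

Definition supcCSRO (E : finType) (S1 S2 Sk : {set E})
    (G1 : generator S1) (G2 : generator S2) (Gk : generator Sk)
    (Su So : {set E}) (K : language E) : language E :=
  \bigcup_(K' in [set K' | [/\ K' `<=` K,
                               cond_controllable G1 G2 Gk Su K' &
                               cond_strong_observable G1 G2 Gk So K K']]) K'.

(* Main.v *)
(* Since Sigma_{1+k} and Sigma_{2+k} meet exactly in Sigma_k, words over them
   with the same projection to Sigma_k can be merged.  With nonconflictingness
   this says that the closure of P_{i+k}(M) consists of the words of the closure
   of supCRO_{i+k} whose projection to Sigma_k lies in the closure of P_k(M).
   The properties of P_{i+k}(M) are therefore those of supCRO_{i+k}, relative to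
   a smaller plant.  Conversely, the projections of a conditionally controllable
   and conditionally strong K-observable N are competitors in the suprema
   defining supCRO_k and supCRO_{i+k}, so N is contained in M. *)
Require Import Defs.
From HB Require Import structures.
From mathcomp Require Import all_boot.
From mathcomp Require Import boolp classical_sets.

Set Implicit Arguments.
Unset Strict Implicit.
Unset Printing Implicit Defensive.

Local Open Scope classical_set_scope.

(** * Prefix closures, projections and generated languages *)

Lemma subset_pclosure (E : finType) (L L' : language E) :
  L `<=` L' -> pclosure L `<=` pclosure L'.
Proof. by move=> sLL' s [w /sLL' Lw sw]; exists w. Qed.

Lemma sub_pclosure (E : finType) (L : language E) : L `<=` pclosure L.
Proof. by move=> w Lw; exists w; rewrite ?prefix_refl. Qed.

Lemma pclosure_bigcup (E : finType) (F : set (language E)) :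
  pclosure (\bigcup_(K in F) K) = \bigcup_(K in F) pclosure K.
Proof.
apply/seteqP; split=> [s [w [K FK Kw] sw]|s [K FK [w Kw sw]]].
  by exists K => //; exists w.
by exists w => //; exists K.
Qed.

Lemma proj_proj (E : finType) (S D : {set E}) (w : seq E) :
  S \subset D -> proj S (proj D w) = proj S w.
Proof.
move=> /fintype.subsetP sSD; rewrite /proj -filter_predI.
by apply: eq_filter => a /=; case: (boolP (a \in S)) => // /sSD.
Qed.

Lemma proj_words (E : finType) (S : {set E}) (w : seq E) : words S (proj S w).
Proof. exact: filter_all. Qed.

Lemma proj_id (E : finType) (S : {set E}) (w : seq E) :
  words S w -> proj S w = w.
Proof. exact/all_filterP. Qed.

Lemma proj_rcons (E : finType) (S : {set E}) (w : seq E) (a : E) :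
  proj S (rcons w a) = if a \in S then rcons (proj S w) a else proj S w.
Proof. exact: filter_rcons. Qed.

Lemma prefix_proj (E : finType) (S : {set E}) (s w : seq E) :
  prefix s w -> prefix (proj S s) (proj S w).
Proof. by case/prefixP=> t ->; rewrite /proj filter_cat prefix_prefix. Qed.

Lemma prefix_proj_lift (E : finType) (S : {set E}) (s w : seq E) :
  prefix s (proj S w) -> exists2 t, prefix t w & proj S t = s.
Proof.
elim: w s => [|a w IHw] s /=; first by case: s => // _; exists [::].
case: ifPn => [aS|/negbTE aNS]; last first.
  by case/IHw=> t tw <-; exists (a :: t); rewrite /= ?eqxx ?aNS.
case: s => [|b s] /=; first by exists [::].
case/andP=> /eqP-> /IHw[t tw <-].
by exists (a :: t); rewrite /= ?eqxx ?aS.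
Qed.

Lemma pclosure_proj (E : finType) (S : {set E}) (L : language E) :
  pclosure (proj S @` L) = proj S @` pclosure L.
Proof.
apply/seteqP; split=> [s [_ [w Lw <-]]|_ [s [w Lw sw] <-]].
  by case/prefix_proj_lift=> t tw <-; exists t => //; exists w.
by exists (proj S w); [exists w|apply: prefix_proj].
Qed.

Lemma gen_lang_prefix (E : finType) (S : {set E}) (G : generator S) :
  pclosure (gen_lang G) `<=` gen_lang G.
Proof.
move=> s [w + /prefixP[t w_st]]; rewrite {}w_st /gen_lang /=.
elim: s (ginit G) => [//|a s IHs] q /=.
by case: (gtrans q a) => //= q'; apply: IHs.
Qed.

Lemma marked_gen_lang (E : finType) (S : {set E}) (G : generator S) :
  marked_lang G `<=` gen_lang G.
Proof. by move=> w [q e _]; rewrite /gen_lang /= e. Qed.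

(** * Synchronous products and the merging of words *)

Lemma sync_comm (E : finType) (S1 S2 : {set E}) (L1 L2 : language E) :
  sync S1 S2 L1 L2 = sync S2 S1 L2 L1.
Proof. by rewrite /sync finset.setUC -!setIA [X in _ `&` X]setIC. Qed.

Lemma sub_sync (E : finType) (S1 S2 : {set E}) (L1 L1' L2 L2' : language E) :
  L1 `<=` L1' -> L2 `<=` L2' -> sync S1 S2 L1 L2 `<=` sync S1 S2 L1' L2'.
Proof. by move=> s1 s2 w [[ww /s1 w1] /s2 w2]. Qed.

Lemma nonconflicting_comm (E : finType) (S1 S2 : {set E})
    (L1 L2 : language E) :
  nonconflicting S1 S2 L1 L2 -> nonconflicting S2 S1 L2 L1.
Proof. by rewrite /nonconflicting sync_comm => ->; rewrite sync_comm. Qed.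

(** A first letter that is not shared is emitted at once; when both first letters are shared, the
    equal projections force them to coincide and they are emitted together. Since either word may be
    the one that shrinks, the induction is on the sum of the lengths. *)
Lemma words_merge (E : finType) (A B : {set E}) (u v : seq E) :
  words A u -> words B v -> proj (A :&: B) u = proj (A :&: B) v ->
  exists2 w, words (A :|: B) w & proj A w = u /\ proj B w = v.
Proof.
rewrite /words /=; have [n] := ubnP (size u + size v).
elim: n u v => // n IHn [|a u] v.
  move=> _ _ wv; rewrite /= => v0; exists v.
    by apply: sub_all wv => x xB; rewrite finset.in_setU xB orbT.
  split; last exact: proj_id.
  (* The empty word is rewritten as the projection of [v] to [A :&: B], which is also its projection
     to [A] because all its letters lie in [B]. *)
  rewrite [RHS]v0; apply: eq_in_filter => x xv.
  by rewrite finset.in_setI (allP wv x xv) andbT.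
rewrite /= ltnS => le_n /andP[aA wu] wv.
rewrite finset.in_setI aA /=; case: ifPn => [aB|aNB] e; last first.
  have [w ww [w1 w2]] := IHn u v le_n wu wv e.
  exists (a :: w); first by rewrite /= finset.in_setU aA.
  by rewrite /= aA (negbTE aNB) w1 w2.
case: v le_n wv e => [//|b v] /=; rewrite addnS => le_n /andP[bB wv].
rewrite finset.in_setI bB andbT; case: ifPn => [bA [<- e]|bNA e].
  have [w ww [w1 w2]] := IHn u v (ltnW le_n) wu wv e.
  exists (a :: w); first by rewrite /= finset.in_setU aA.
  by rewrite /= aA aB w1 w2.
have [|||w ww [w1 w2]] := IHn (a :: u) v _ _ wv.
- by rewrite /= addSn.
- by rewrite /= aA.
- by rewrite /= finset.in_setI aA aB.
exists (b :: w); first by rewrite /= finset.in_setU bB orbT.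
by rewrite /= bB (negbTE bNA) w1 w2.
Qed.

Lemma pclosure_words (E : finType) (S : {set E}) (L : language E) :
  L `<=` words S -> pclosure L `<=` words S.
Proof.
move=> sLS s [w /sLS + /prefixP[t w_st]].
by rewrite /words w_st /= all_cat => /andP[].
Qed.

(** Nonconflictingness turns the closure of the product into the product of the closures, where
    membership is tested on each component separately. A word of the closure of [L1] can then be
    merged with the [B]-component of any word of that product having the same shared projection. *)
Lemma pclosure_proj_sync (E : finType) (A B : {set E}) (L1 L2 : language E) :
  L1 `<=` words A -> L2 `<=` words B -> nonconflicting A B L1 L2 ->
  pclosure (proj A @` sync A B L1 L2) =
  pclosure L1 `&`
    proj (A :&: B) @^-1` pclosure (proj (A :&: B) @` sync A B L1 L2).
Proof.
move=> w1 w2 nc; rewrite !pclosure_proj nc.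
apply/seteqP; split=> [_ [w Mw <-]|s].
  split; first by case: Mw => -[].
  by exists w; rewrite // proj_proj // finset.subsetIl.
case=> L1s [w [[_ _] L2w]] w_s.
have [||t tw [t1 t2]] := @words_merge E A B s (proj B w) _ (proj_words B w).
- exact: pclosure_words w1 _ L1s.
- by rewrite -w_s proj_proj // finset.subsetIr.
by exists t => //; split; [split=> //|]; rewrite /preimage /= ?t1 ?t2.
Qed.

(** * Supremal controllable and relatively observable sublanguages *)

Lemma supCRO_sub (E : finType) (D Su So : {set E}) (K L : language E) :
  supCRO D Su So K L `<=` K `&` L.
Proof. by move=> w [K' [sK' _ _]] /sK'. Qed.

Lemma supCRO_controllable (E : finType) (D Su So : {set E})
    (K L : language E) :
  controllable L (D :&: Su) (supCRO D Su So K L).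
Proof.
split=> [w Cw|s a]; first by have [] := supCRO_sub Cw.
rewrite /supCRO pclosure_bigcup => -[K' hK' sK'] aDu Lsa.
by exists K' => //; case: hK' => _ [_]/(_ s a sK' aDu Lsa).
Qed.

(** The condition on [s'] refers to a language common to all competitors, so the single competitor
    that provides [rcons s a] also provides [rcons s' a]. *)
Lemma supCRO_observable (E : finType) (D Su So : {set E})
    (K L : language E) :
  rel_observable D L (proj (D :&: So)) (K `&` L) (supCRO D Su So K L).
Proof.
split=> [|s s' a ws ws' aD Qss']; first exact: supCRO_sub.
rewrite /supCRO pclosure_bigcup => -[K' hK' sK'] Cs' Lsa.
by exists K' => //; case: hK' => _ _ [_]/(_ s s' a ws ws' aD Qss' sK' Cs' Lsa).
Qed.

(** The plant and the reference language only restrict [s'], so shrinking either one weakens the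
    requirement. *)
Lemma rel_observableS (E : finType) (D : {set E}) (L L' : language E)
    (Q : seq E -> seq E) (C C' K : language E) :
  L' `<=` L -> C' `<=` C -> K `<=` C' ->
  rel_observable D L Q C K -> rel_observable D L' Q C' K.
Proof.
move=> sL sC sK [_ obs]; split=> // s s' a ws ws' aD Qss' Ksa Cs' Lsa.
apply: (obs s s') => //; [exact: subset_pclosure sC _ Cs'|exact: sL].
Qed.

(** By the first hypothesis there are two things to check for an extended word: membership in the
    closure of [CRO], inherited from the larger plant built on [X], and the constraint on [Sk],
    already imposed by the plant built on [PkN]. *)
Lemma supCRO_component (E : finType) (S Sk Su So : {set E})
    (P LS X N : language E) :
  let D := S :|: Sk in
  let PkN := pclosure (proj Sk @` N) in
  let CRO := supCRO D Su So P (sync S Sk LS X) in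
  pclosure (proj D @` N) = pclosure CRO `&` proj Sk @^-1` PkN ->
  PkN `<=` X -> proj D @` N `<=` sync S Sk LS PkN ->
  controllable (sync S Sk LS PkN) (D :&: Su) (proj D @` N) /\
  observable D (sync S Sk LS PkN) (proj (D :&: So)) (proj D @` N).
Proof.
move=> D PkN CRO clN sX sN.
have sL : sync S Sk LS PkN `<=` sync S Sk LS X by apply: sub_sync.
split; split=> //.
  move=> s a; rewrite clN => -[Cs _] aDu Lsa; split; last by case: Lsa.
  exact: (supCRO_controllable _ _ _ _ _).2 Cs aDu (sL _ Lsa).
move=> s s' a ws ws' aD Qss'; rewrite clN => -[Csa _] [Cs' _] Lsa.
split; last by case: Lsa.
apply: (supCRO_observable _ _ _ _ _).2 ws ws' aD Qss' Csa _ (sL _ Lsa).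
exact: subset_pclosure (@supCRO_sub _ _ _ _ _ _) _ Cs'.
Qed.

(* An uncontrollable continuation allowed by [X] but not a priori by [PkN]
   is recovered from the controllability of [proj Sk @` N]. *)
Lemma sub_supCRO_component (E : finType) (S Sk Su So : {set E})
    (Gk : generator Sk) (K LS X N : language E) :
  let D := S :|: Sk in
  let PkN := pclosure (proj Sk @` N) in
  N `<=` K -> PkN `<=` X -> X `<=` gen_lang Gk ->
  controllable (gen_lang Gk) (Sk :&: Su) (proj Sk @` N) ->
  controllable (sync S Sk LS PkN) (D :&: Su) (proj D @` N) ->
  rel_observable D (sync S Sk LS (gen_lang Gk)) (proj (D :&: So))
    (proj D @` K) (proj D @` N) ->
  proj D @` N `<=` supCRO D Su So (proj D @` K) (sync S Sk LS X).
Proof.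
move=> D PkN sNK sX sXk [_ ck] [sN cN] oN w Nw; exists (proj D @` N) => //.
have sNX : proj D @` N `<=` (proj D @` K) `&` sync S Sk LS X.
  move=> v Nv; split; first exact: image_subset sNK _ Nv.
  exact: sub_sync sX _ (sN _ Nv).
split=> //; last first.
  (* Strongness matters here: the plant of [oN] is built on all of [gen_lang Gk], which contains
     [X], whereas one built on [PkN] could be too small. *)
  by apply: rel_observableS oN => //; exact: sub_sync.
split=> [v /sNX[]//|s a Ns aDu [[wsa Lsa] Xsa]].
apply: cN => //; split=> //; move: Xsa; rewrite /preimage /= proj_rcons.
have Nks : PkN (proj Sk s).
  move: Ns; rewrite /PkN !pclosure_proj => -[t Nt <-].
  by exists t; rewrite // proj_proj // finset.subsetUr.
case: ifP => // aSk /sXk; apply: ck => //.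
by move: aDu; rewrite !finset.in_setI aSk => /andP[].
Qed.

(** * Conditional properties of [M] and its lower bound *)

Theorem theorem10 (E : finType) (S1 S2 Sk Sc So : {set E})
    (hk_lo : S1 :&: S2 \subset Sk) (hk_up : Sk \subset S1 :|: S2)
    (hSc : Sc \subset S1 :|: S2) (hSo : So \subset S1 :|: S2)
    (G1 : generator S1) (G2 : generator S2) (Gk : generator Sk)
    (K : language E)
    (hK : K `<=` marked_lang (sync_gen (sync_gen G1 G2) Gk))
    (hdec : cond_decomposable S1 S2 Sk K)
    (hdec_bar : cond_decomposable S1 S2 Sk (pclosure K)) :
  let Su := (S1 :|: S2) :\: Sc in
  let supCROk := supCRO Sk Su So (proj Sk @` K) (gen_lang Gk) in
  let supCRO1k := supCRO (S1 :|: Sk) Su So (proj (S1 :|: Sk) @` K)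
                    (sync S1 Sk (gen_lang G1) (pclosure supCROk)) in
  let supCRO2k := supCRO (S2 :|: Sk) Su So (proj (S2 :|: Sk) @` K)
                    (sync S2 Sk (gen_lang G2) (pclosure supCROk)) in
  let M := sync (S1 :|: Sk) (S2 :|: Sk) supCRO1k supCRO2k in
  let L := gen_lang (sync_gen (sync_gen G1 G2) Gk) in
  nonconflicting (S1 :|: Sk) (S2 :|: Sk) supCRO1k supCRO2k ->
  controllable (gen_lang Gk) (Sk :&: Su) (proj Sk @` M) ->
  (exists C : language E,
     [/\ M `<=` C, C `<=` L &
         rel_observable Sk (gen_lang Gk) (proj (Sk :&: So))
           (proj Sk @` C) (proj Sk @` M)]) ->
  [/\ cond_controllable G1 G2 Gk Su M,
      cond_observable G1 G2 Gk So M &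
      supcCSRO G1 G2 Gk Su So K `<=` M].
Proof.
move=> Su supCROk supCRO1k supCRO2k M L nc ck [C [sMC _ oC]].
have eqAk : (S1 :|: Sk) :&: (S2 :|: Sk) = Sk.
  by rewrite -finset.setUIl; apply/finset.setUidPr.
have w1 : supCRO1k `<=` words (S1 :|: Sk).
  by move=> w Cw; have [[v _ <-] _] := supCRO_sub Cw; exact: proj_words.
have w2 : supCRO2k `<=` words (S2 :|: Sk).
  by move=> w Cw; have [[v _ <-] _] := supCRO_sub Cw; exact: proj_words.
(* Conditional decomposability makes [K] the product of its two projections, which contain
   [supCRO1k] and [supCRO2k]. *)
have sMK : M `<=` K.
  by rewrite hdec; apply: sub_sync => w Cw; have [] := supCRO_sub Cw.
have sLm : M `<=` marked_lang (sync_gen (sync_gen G1 G2) Gk).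
  exact: subset_trans sMK hK.
(* The first component suffices: [supCRO1k] lies in a plant whose [Sk]-part is the closure of
   [supCROk]. *)
have MX : pclosure (proj Sk @` M) `<=` pclosure supCROk.
  rewrite pclosure_proj => _ [w [v Mv wv] <-].
  have [[_ Cv] _] := Mv; have [_ [_ [u Xu vu]]] := supCRO_sub Cv.
  exists u => //; apply: prefix_trans vu.
  by rewrite proj_proj ?finset.subsetUr //; apply: prefix_proj.
have cl1 : pclosure (proj (S1 :|: Sk) @` M) =
    pclosure supCRO1k `&` proj Sk @^-1` pclosure (proj Sk @` M).
  by rewrite /M pclosure_proj_sync // eqAk.
have cl2 : pclosure (proj (S2 :|: Sk) @` M) =
    pclosure supCRO2k `&` proj Sk @^-1` pclosure (proj Sk @` M).
  have := pclosure_proj_sync w2 w1 (nonconflicting_comm nc).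
  by rewrite finset.setIC eqAk sync_comm.
have inL (v : seq E) :
    M v -> gen_lang G1 (proj S1 v) /\ gen_lang G2 (proj S2 v).
  move=> /sLm /marked_gen_lang; rewrite !gen_lang_sync => -[[_ [[_ +] +]] _].
  by rewrite /= !proj_proj ?finset.subsetUl ?finset.subsetUr.
have s1 : proj (S1 :|: Sk) @` M `<=`
    sync S1 Sk (gen_lang G1) (pclosure (proj Sk @` M)).
  move=> _ [v Mv <-]; split; first split; first exact: proj_words.
    by rewrite /= proj_proj ?finset.subsetUl //; case: (inL _ Mv).
  by rewrite /= proj_proj ?finset.subsetUr //; apply: sub_pclosure; exists v.
have s2 : proj (S2 :|: Sk) @` M `<=`
    sync S2 Sk (gen_lang G2) (pclosure (proj Sk @` M)).
  move=> _ [v Mv <-]; split; first split; first exact: proj_words.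
    by rewrite /= proj_proj ?finset.subsetUl //; case: (inL _ Mv).
  by rewrite /= proj_proj ?finset.subsetUr //; apply: sub_pclosure; exists v.
have [c1 o1] := supCRO_component cl1 MX s1.
have [c2 o2] := supCRO_component cl2 MX s2.
split; [by split|split=> //|].
  (* The coordinator part follows by shrinking the reference language from [C] to [M]. *)
  by apply: rel_observableS oC => //; exact: image_subset.
move=> w [N [sNK [sNm ckN c1N c2N] [_ okN o1N o2N]] Nw].
(* The coordinator level comes first, because the plants defining [supCRO1k] and [supCRO2k] are
   built on [supCROk]. *)
have NX : pclosure (proj Sk @` N) `<=` pclosure supCROk.
  apply: subset_pclosure => v Nv; exists (proj Sk @` N) => //.
  have sN : proj Sk @` N `<=` (proj Sk @` K) `&` gen_lang Gk.
    move=> u Nu; split; first exact: image_subset sNK _ Nu.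
    by case: ckN => + _; apply.
  by split=> //; apply: rel_observableS okN => //; exact: subIsetl.
have Xk : pclosure supCROk `<=` gen_lang Gk.
  apply: subset_trans (@gen_lang_prefix _ _ Gk).
  by apply: subset_pclosure => v Cv; have [] := supCRO_sub Cv.
split; first split.
- have /marked_gen_lang := sNm _ Nw.
  by rewrite gen_lang_sync -finset.setUUl => -[[]].
- by apply: (sub_supCRO_component sNK NX Xk ckN c1N o1N); exists w.
- by apply: (sub_supCRO_component sNK NX Xk ckN c2N o2N); exists w.
Qed.
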